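(* Let $\mathbb{F}$ be a field of characteristic zero. Let $P \in \mathbb{F}[x_1,\dots,x_n, y]$ be a nonzero polynomial of degree at most $r$ that can be computed by an arithmetic circuit of size $s$ and depth at most $\Delta$. Let $f\in \mathbb{F}[x_1,\dots,x_n]$ be a polynomial of degree at most $d$ such that $P(x_1,\dots,x_n, f(x_1,\dots,x_n)) = 0$. Then $f$ can be computed by an arithmetic circuit of depth at most $\Delta + 3$ and size at most $O((srn)^{10}\cdot d^{O(\sqrt{d})})$.
   Context: An arithmetic circuit is a directed acyclic graph whose in-degree-zero nodes are labeled by field elements or variables and whose internal nodes are sum or product gates of unbounded fan-in; it computes polynomials in the natural way. Size is the number of wires; depth is the length of a longest path from an output to an input. Circuits are layered with alternating layers of sum and product gates, the top layer consisting of sum gates. *)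

(* Defs.v *)
From HB Require Import structures.
From mathcomp Require Import all_boot all_order all_algebra.
From mathcomp.multinomials Require Export mpoly.

Set Implicit Arguments.
Unset Strict Implicit.
Unset Printing Implicit Defensive.

Import GRing.Theory.
Local Open Scope ring_scope.

Variant label (F : fieldType) (m : nat) :=
  | LConst of F
  | LVar of 'I_m
  | LSum
  | LProd.
Arguments LConst {F m}.
Arguments LVar {F m}.
Arguments LSum {F m}.
Arguments LProd {F m}.

Definition is_input (F : fieldType) (m : nat) (l : label F m) : bool :=
  match l with LConst _ | LVar _ => true | LSum | LProd => false end.

(* [cfanin x] lists the tails of the wires entering [x]; a node occurring k
   times in it is joined to [x] by k parallel wires.  Wires carry no scalars.
   Layers are numbered downwards from the output: sum gates sit on even layers,
   product gates on odd ones, and wires between gates join consecutive layers.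
   Inputs are not assigned to a layer and may feed any gate. *)
Record circuit (F : fieldType) (m : nat) := Circuit {
  cnode : finType;
  clabel : cnode -> label F m;
  cfanin : cnode -> seq cnode;
  cout : cnode;
  c_input : forall x, nilp (cfanin x) = is_input (clabel x);
  c_acyclic : forall x y, y \in cfanin x -> ~~ connect (grel cfanin) y x;
  c_layered : exists layer : cnode -> nat,
    [/\ layer cout = 0%N,
        forall x, clabel x = LSum -> ~~ odd (layer x),
        forall x, clabel x = LProd -> odd (layer x) &
        forall x y, y \in cfanin x -> ~~ is_input (clabel y) ->
          layer y = (layer x).+1];
  c_top : clabel cout = LSum
}.

Definition csize (F : fieldType) (m : nat) (c : circuit F m) : nat :=
  (\sum_(x : cnode c) size (cfanin x))%N.

(* [path] walks along wires backwards, from the output towards the inputs. *)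
Definition depth_at_most (F : fieldType) (m : nat) (c : circuit F m)
    (D : nat) : Prop :=
  forall p : seq (cnode c),
    path (grel (@cfanin F m c)) (cout c) p ->
    is_input (clabel (last (cout c) p)) -> (size p <= D)%N.

Definition gate_value (F : fieldType) (m : nat) (c : circuit F m)
    (v : cnode c -> {mpoly F[m]}) (x : cnode c) : {mpoly F[m]} :=
  match clabel x with
  | LConst a => a%:MP
  | LVar i => 'X_i
  | LSum => \sum_(y <- cfanin x) v y
  | LProd => \prod_(y <- cfanin x) v y
  end.

(* By acyclicity there is exactly one such [v]: see [valuation_unique] and
   [valuation_exists] below. *)
Definition valuation (F : fieldType) (m : nat) (c : circuit F m)
    (v : cnode c -> {mpoly F[m]}) : Prop :=
  forall x, v x = gate_value v x.

Definition computes (F : fieldType) (m : nat) (c : circuit F m)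
    (p : {mpoly F[m]}) : Prop :=
  exists2 v : cnode c -> {mpoly F[m]}, valuation v & v (cout c) = p.

(* e(d) = O(sqrt d), i.e. e(d) <= k * sqrt d for some constant k. *)
Definition bigO_sqrt (e : nat -> nat) : Prop :=
  exists k : nat, forall d : nat, (e d ^ 2 <= k ^ 2 * d)%N.

Section Valuation.
Variables (F : fieldType) (m : nat) (c : circuit F m).
Local Notation e := (grel (@cfanin F m c)).
Implicit Types v w : cnode c -> {mpoly F[m]}.

Lemma circuit_path_uniq x p : path e x p -> uniq (x :: p).
Proof.
elim: p x => [|y p IH] x //= /andP[xy yp].
have /= -> := IH _ yp; rewrite andbT.
apply/negP => xyp; have := c_acyclic xy; apply/negP; rewrite negbK.
by apply: (path_connect yp).
Qed.

Lemma eq_gate_value v w x :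
  {in cfanin x, v =1 w} -> gate_value v x = gate_value w x.
Proof.
by move=> vw; rewrite /gate_value; case: (clabel x) => //; exact: eq_big_seq.
Qed.

Lemma circuit_ind (Q : cnode c -> Prop) :
  (forall x, {in cfanin x, forall y, Q y} -> Q x) -> forall x, Q x.
Proof.
move=> H x.
have: forall p, path e x p -> (size p < #|cnode c|)%N.
  by move=> p /circuit_path_uniq/card_uniqP Ep; rewrite -[_.+1]Ep max_card.
elim: #|_| x => [|k IH] x Hx; first by have := Hx [::] isT.
apply: H => y xy; apply: IH => p yp.
by apply: (Hx (y :: p)); rewrite /= xy.
Qed.

Lemma valuation_unique v w : valuation v -> valuation w -> v =1 w.
Proof.
move=> Hv Hw; apply: circuit_ind => x IH.
by rewrite Hv Hw; exact: eq_gate_value.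
Qed.

Lemma valuation_exists : exists v, valuation v.
Proof.
pose ev k := iter k (@gate_value F m c) (fun=> 0).
have stable k x : (forall p, path e x p -> (size p < k)%N) ->
    ev k x = ev k.+1 x.
  elim: k x => [|k IH] x Hx; first by have := Hx [::] isT.
  apply: eq_gate_value => y xy; apply: IH => p yp.
  by apply: (Hx (y :: p)); rewrite /= xy.
exists (ev #|cnode c|) => x; apply: stable => p.
by move=> /circuit_path_uniq/card_uniqP Ep; rewrite -[_.+1]Ep max_card.
Qed.

End Valuation.

(* Main.v *)
Require Import Defs.
From HB Require Import structures.
From mathcomp Require Import all_boot all_algebra.
From mathcomp Require Import zify ring.

(**
  Differentiating [P] in [y], we may assume that [f] is a simple root:
  [Q(x, f) = 0] and [q := (dQ/dy)(a, f(a)) <> 0] for some point [a].  Put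
  [y0 := f(a)], [g(t) := f(a + t (x - a)) - y0] and
  [phi(z) := z - Q(a + t (x - a), y0 + z) / q].  Then [g] is a fixed point of
  [phi] and, modulo [t], it vanishes while [phi] is divisible by [z^2]; hence
  Lagrange inversion gives [g = sum_m (1/m) [z^(m-1)] phi(z)^m], where only the
  terms with [m <= 2 d] contribute modulo [t^(d+1)].  Since [f = y0 + g(1)] and
  [g] has degree at most [d] in [t], interpolation in [z] and [t] (and in [y],
  to express [Q] through [P]) writes [f] as a linear combination of powers of
  linear combinations of polynomials [P(l x + (1 - l) a, k)] with [l] and [k]
  natural numbers.  This is a circuit of depth [Delta + 3] and of size
  polynomial in [s], [r] and [d]: the exponent of [d] is bounded, and no depth
  reduction is needed.
*)

Set Implicit Arguments.
Unset Strict Implicit.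
Unset Printing Implicit Defensive.

Import GRing.Theory.
Local Open Scope ring_scope.

(** * Lagrange inversion *)

Lemma telescope_sumrB (V : zmodType) (u : nat -> V) N :
  \sum_(m < N) (u m - u m.+1) = u 0%N - u N.
Proof.
rewrite -[RHS]opprB -(telescope_sumr u) // big_mkord -sumrN.
by apply: eq_bigr => m _; rewrite opprB.
Qed.

Section Order.
Variable A : comNzRingType.
Implicit Types (u v : {poly A}) (p q : {poly {poly A}}).

Definition order_ge k u : Prop := forall a, (a < k)%N -> u`_a = 0.

(* The variable [t] of the coefficients has weight 2, the outer variable [z] has
   weight 1. *)
Definition weight_ge k p : Prop :=
  forall i a, (2 * a + i < k)%N -> p`_i`_a = 0.

Lemma order_geD k u v : order_ge k u -> order_ge k v -> order_ge k (u + v).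
Proof. by move=> ku kv a ak; rewrite coefD ku // kv // addr0. Qed.

Lemma order_geN k u : order_ge k u -> order_ge k (- u).
Proof. by move=> ku a ak; rewrite coefN ku // oppr0. Qed.

Lemma order_geMr k u v : order_ge k u -> order_ge k (u * v).
Proof.
move=> ku a ak; rewrite coefM big1 // => j _.
by rewrite ku ?mul0r // (leq_ltn_trans _ ak) // -ltnS.
Qed.

Lemma order_ge_sum k I (r : seq I) (u : I -> {poly A}) :
  (forall i, order_ge k (u i)) -> order_ge k (\sum_(i <- r) u i).
Proof. by move=> ku a ak; rewrite coef_sum big1 // => i _; apply: ku. Qed.

Lemma weight_geX : weight_ge 1 'X.
Proof. by move=> [|i] a; rewrite coefX ?coef0 // addnS ltnS ltn0. Qed.

Lemma weight_geM k l p q :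
  weight_ge k p -> weight_ge l q -> weight_ge (k + l) (p * q).
Proof.
move=> kp lq i a lt_kl; rewrite coefM coef_sum big1 // => -[j /= lt_j] _.
rewrite coefM big1 // => -[b /= lt_b] _.
have [lt_k|ge_k] := ltnP (2 * b + j) k; first by rewrite kp // mul0r.
by rewrite [q`_ _`__]lq ?mulr0 //; lia.
Qed.

Lemma weight_geMr k p q : weight_ge k p -> weight_ge k (p * q).
Proof. by move=> kp; rewrite -[k]addn0; apply: weight_geM. Qed.

Lemma weight_geXn k p m : weight_ge k p -> weight_ge (m * k) (p ^+ m).
Proof.
by move=> kp; elim: m => [|m IH] //; rewrite exprS; apply: weight_geM.
Qed.

Lemma order_coef_weight k p d i :
  weight_ge k p -> (2 * d + i < k)%N -> order_ge d.+1 p`_i.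
Proof. by move=> kp lt_k a; rewrite ltnS => le_a; apply: kp; lia. Qed.

End Order.

Section LagrangeInversion.
Variables (A : comUnitRingType) (phi : {poly {poly A}}) (g : {poly A}).
Hypothesis natr_unit : forall m, m.+1%:R \is a @GRing.unit A.
Hypotheses (phi00 : phi`_0`_0 = 0) (phi10 : phi`_1`_0 = 0).
Hypotheses (phi_fix : phi.[g] = g) (g0 : g`_0 = 0).
Variables (d N : nat).
Hypothesis lt_dN : (2 * d < N)%N.
Implicit Types (u : {poly A}) (h : {poly {poly A}}).

(* Truncation of the residue at [z = 0] of [h / (z - phi)], where
   [1 / (z - phi)] is expanded in powers of [phi / z]. *)
Definition residue h : {poly A} := \sum_(m < N) (h * phi ^+ m)`_m.

Lemma residueD h1 h2 : residue (h1 + h2) = residue h1 + residue h2.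
Proof.
by rewrite /residue -big_split; apply: eq_bigr => m _; rewrite mulrDl coefD.
Qed.

Lemma residueCM u h : residue (u%:P * h) = u * residue h.
Proof.
by rewrite /residue mulr_sumr; apply: eq_bigr => m _; rewrite -mulrA coefCM.
Qed.

Lemma weight_phiX m : weight_ge (m * 2) (phi ^+ m).
Proof.
by apply: weight_geXn => -[|[|i]] [|a] //; rewrite mulnS.
Qed.

Lemma order_residue h : weight_ge (2 * d).+1 h -> order_ge d.+1 (residue h).
Proof.
move=> wh; apply: order_ge_sum => m.
by apply: (order_coef_weight (weight_geM wh (@weight_phiX m))); lia.
Qed.

Lemma order_coef_X_phiX h : order_ge d.+1 ('X * h * phi ^+ N)`_N.
Proof.
have wX := weight_geMr h (@weight_geX A).
by apply: (order_coef_weight (weight_geM wX (@weight_phiX N))); lia.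
Qed.

Lemma residue_Xsub_phi h : order_ge d.+1 (residue (('X - phi) * h)).
Proof.
have -> : residue (('X - phi) * h) = - ('X * h * phi ^+ N)`_N.
  pose u m := ('X * h * phi ^+ m)`_m.
  transitivity (u 0%N - u N); last by rewrite /u expr0 mulr1 coefXM sub0r.
  rewrite -telescope_sumrB; apply: eq_bigr => m _.
  rewrite -mulrA mulrBl coefB mulrA; congr (_ - _).
  by rewrite /u -mulrA coefXM /= exprS; congr (nth _ (polyseq _) _); ring.
exact/order_geN/order_coef_X_phiX.
Qed.

Lemma Xsub_phi_factor :
  exists2 psi, 'X - phi = (1 - psi) * ('X - g%:P) & weight_ge 1 psi.
Proof.
have /factor_theorem [theta phiE] : root ('X - phi) g.
  by rewrite rootE hornerD hornerN hornerX phi_fix subrr.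
exists (1 - theta); first by rewrite subKr.
move=> i a; rewrite ltnS leqn0 addn_eq0 muln_eq0 /= => /andP[/eqP-> /eqP->].
have /= := congr1 (fun p : {poly {poly A}} => p`_1`_0) phiE.
rewrite mulrBr !coefB coefX coefMX /= coefMC phi10 subr0.
by rewrite coef0M g0 mulr0 subr0 !coef1 /= => <-; rewrite subrr.
Qed.

(* [1 - psi] is invertible up to the topologically nilpotent [psi]. *)
Lemma residue_Xsub_g h : order_ge d.+1 (residue (('X - g%:P) * h)).
Proof.
have [psi phiE psi_w] := Xsub_phi_factor; pose K := (2 * d).+1.
have -> : ('X - g%:P) * h =
    ('X - phi) * ((\sum_(k < K) psi ^+ k) * h) + psi ^+ K * (('X - g%:P) * h).
  have psiX : psi ^+ K = 1 - (1 - psi) * \sum_(k < K) psi ^+ k.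
    by rewrite -[1 - psi]opprB mulNr opprK -subrX1 addrC subrK.
  by rewrite psiX phiE; ring.
rewrite residueD; apply: order_geD; first exact: residue_Xsub_phi.
apply/order_residue/weight_geMr; rewrite -[_.+1]muln1.
exact: weight_geXn psi_w.
Qed.

Lemma residue_horner h : order_ge d.+1 (residue h - h.[g] * residue 1).
Proof.
have /factor_theorem [q hq] : root (h - h.[g]%:P) g.
  by rewrite rootE hornerD hornerN hornerC subrr.
have -> : residue h - h.[g] * residue 1 = residue (('X - g%:P) * q).
  by rewrite [_ * q]mulrC -hq residueD -polyCN -[(- _)%:P]mulr1 residueCM mulNr.
exact: residue_Xsub_g.
Qed.

Lemma scaler_natVK m u : m.+1%:R^-1 *: u *+ m.+1 = u.
Proof. by rewrite scalerMnr -scaler_nat scalerA mulVr ?scale1r. Qed.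

Lemma coef_deriv_mulX m j :
  (phi^`() * phi ^+ m)`_j = m.+1%:R^-1 *: (phi ^+ m.+1)`_j.+1 *+ j.+1.
Proof.
rewrite scalerMnr -coef_deriv deriv_exp /= coefMn -scalerMnr scaler_natVK.
by rewrite mulrC.
Qed.

Lemma residue_deriv : order_ge d.+1 (residue (1 - phi^`()) - 1).
Proof.
have -> : residue (1 - phi^`()) - 1 = - (phi ^+ N)`_N.
  pose u m := (phi ^+ m)`_m.
  transitivity (u 0%N - u N - u 0%N); last by rewrite addrC addKr.
  rewrite -telescope_sumrB /u coef1; congr (_ - _).
  apply: eq_bigr => m _; rewrite mulrBl mul1r coefB coef_deriv_mulX.
  by rewrite scaler_natVK.
by apply: order_geN; apply: (order_coef_weight (@weight_phiX N)); lia.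
Qed.

Lemma residue_X_deriv : order_ge d.+1
  (residue ('X * (1 - phi^`())) - \sum_(m < N) m.+1%:R^-1 *: (phi ^+ m.+1)`_m).
Proof.
pose u m := ('X * phi ^+ m)`_m.
have -> : residue ('X * (1 - phi^`())) =
    - u N + \sum_(m < N) m.+1%:R^-1 *: (phi ^+ m.+1)`_m.
  rewrite -[- u N]add0r -{1}[0](_ : u 0%N = 0); last by rewrite /u coefXM.
  rewrite -telescope_sumrB -big_split; apply: eq_bigr => m _ /=.
  rewrite -mulrA mulrBl mul1r mulrBr coefB -addrA; congr (_ + _).
  rewrite /u !coefXM /=; case: (nat_of_ord m) => [|k] /=.
    by rewrite oppr0 invr1 scale1r addNr.
  rewrite coef_deriv_mulX; set w := (phi ^+ k.+2)`_k.+1.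
  by rewrite -{2}[w](scaler_natVK k.+1) [in RHS]mulrSr opprD addrNK.
by rewrite addrK /u -['X]mulr1; apply/order_geN/order_coef_X_phiX.
Qed.

Theorem lagrange_inversion :
  order_ge d.+1 (g - \sum_(m < N) m.+1%:R^-1 *: (phi ^+ m.+1)`_m).
Proof.
set S := \sum_(m < N) _; pose h := 1 - phi^`().
have -> : g - S = - (residue h - 1) * g
    + (residue h - h.[g] * residue 1) * g
    - (residue ('X * h) - ('X * h).[g] * residue 1) + (residue ('X * h) - S).
  by rewrite hornerM hornerX; ring.
apply: order_geD residue_X_deriv; apply: order_geD; last first.
  exact/order_geN/residue_horner.
apply: order_geD; apply: order_geMr; last exact: residue_horner.
exact/order_geN/residue_deriv.
Qed.

End LagrangeInversion.

(** * Interpolation *)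

Lemma poly_eq0_nodes (R : idomainType) (x : nat -> R) D (p : {poly R}) :
  injective x -> (size p <= D)%N -> (forall k : 'I_D, p.[x k] = 0) -> p = 0.
Proof.
move=> x_inj pD px; apply: (@roots_geq_poly_eq0 _ p [seq x k | k <- iota 0 D]).
- apply/allP => _ /mapP[k + ->]; rewrite mem_iota => kD.
  by apply/eqP/(px (Ordinal kD)).
- by rewrite map_inj_uniq ?iota_uniq.
by rewrite size_map size_iota.
Qed.

Lemma lagrange_interpolation (F : fieldType) (R : idomainType)
    (iota : {rmorphism F -> R}) (x : nat -> F) D (p : {poly R}) :
  injective x -> (size p <= D)%N ->
  p = \sum_(k < D) p.[iota (x k)] *: map_poly iota (tnth (D.-lagrange x) k).
Proof.
move=> x_inj pD; apply/eqP; rewrite -subr_eq0; apply/eqP.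
have D_gt0 (k : 'I_D) : (0 < D)%N by apply: leq_ltn_trans (ltn_ord k).
have iota_x_inj : injective (iota \o x).
  by apply: inj_comp x_inj; apply: fmorph_inj.
have sampleE (i k : 'I_D) :
    (map_poly iota (tnth (D.-lagrange x) i)).[iota (x k)] = (i == k)%:R.
  by rewrite horner_map lagrange_sample ?D_gt0 // rmorph_nat.
apply: (@poly_eq0_nodes _ _ D _ iota_x_inj) => [|k /=].
  rewrite (leq_trans (size_polyD _ _)) // geq_max pD size_polyN.
  apply: leq_trans (size_sum _ _ _) _; apply/bigmax_leqP => k _.
  rewrite (leq_trans (size_scale_leq _ _)) // size_map_poly.
  by rewrite size_lagrange_ ?D_gt0.
rewrite hornerD hornerN horner_sum (bigD1 k) //= big1 => [|i ik].
  by rewrite hornerZ sampleE eqxx mulr1 addr0 subrr.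
by rewrite hornerZ sampleE (negbTE ik) mulr0.
Qed.

Lemma natr_inj (R : idomainType) :
  [pchar R] =i pred0 -> injective (fun k => k%:R : R).
Proof.
move=> /pcharf0P char0 i j; wlog: i j / (i <= j)%N => [wl ij|ij].
  by have [/wl->|/ltnW/wl->] := leqP i j.
move/esym/eqP; rewrite -subr_eq0 -natrB // char0 subn_eq0 => ji.
by apply/eqP; rewrite eqn_leq ij.
Qed.

Definition lagrange_nat (F : fieldType) D (k : 'I_D) : {poly F} :=
  tnth (D.-lagrange (fun i => i%:R)) k.

Section NatInterpolation.
Variables (F : fieldType) (R : idomainType) (iota : {rmorphism F -> R}).
Hypothesis char0 : [pchar F] =i pred0.

Lemma nat_interpolation D (p : {poly R}) : (size p <= D)%N ->
  p = \sum_(k < D) p.[k%:R] *: map_poly iota (lagrange_nat F k).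
Proof.
move=> pD; rewrite {1}(lagrange_interpolation iota (natr_inj char0) pD).
by apply: eq_bigr => k _; rewrite rmorph_nat.
Qed.

Lemma coef_interpolation D (p : {poly R}) i : (size p <= D)%N ->
  p`_i = \sum_(k < D) iota (lagrange_nat F k)`_i * p.[k%:R].
Proof.
move=> pD; rewrite {1}(nat_interpolation pD) coef_sum; apply: eq_bigr => k _.
by rewrite coefZ coef_map mulrC.
Qed.

Lemma horner_derivn_interpolation D (p : {poly R}) j x : (size p <= D)%N ->
  p^`(j).[iota x] = \sum_(k < D) iota (lagrange_nat F k)^`(j).[x] * p.[k%:R].
Proof.
move=> pD; rewrite {1}(nat_interpolation pD) raddf_sum /= horner_sum.
by apply: eq_bigr => k _; rewrite derivnZ derivn_map hornerZ horner_map mulrC.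
Qed.

End NatInterpolation.

Lemma coef_interpolation2 (F : fieldType) (R : idomainType)
    (iota : {rmorphism F -> R}) D (p : {poly {poly R}}) i j :
  [pchar F] =i pred0 -> (size p <= D)%N ->
  (forall k : nat, (size p.[k%:R])%R <= D)%N ->
  p`_i`_j = \sum_(k < D) \sum_(l < D)
    iota ((lagrange_nat F k)`_i * (lagrange_nat F l)`_j) * p.[k%:R].[l%:R].
Proof.
move=> char0 pD pkD; rewrite (coef_interpolation (polyC \o iota) char0 i pD).
rewrite coef_sum; apply: eq_bigr => k _; rewrite coefCM.
rewrite (coef_interpolation iota char0 j (pkD k)) mulr_sumr.
by apply: eq_bigr => l _; rewrite rmorphM mulrA.
Qed.

Lemma derivn_nonroot (R : idomainType) (p : {poly R}) x :
  [pchar R] =i pred0 -> p != 0 -> exists j, p^`(j).[x] != 0.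
Proof.
move=> /pcharf0P char0 p0; exists (size p).-1.
have -> : p^`((size p).-1) = (lead_coef p *+ (size p).-1`!)%:P.
  apply/polyP => i; rewrite coef_derivn coefC; case: i => [|i].
    by rewrite addn0 ffactnn.
  rewrite nth_default ?mul0rn // addnS -addSn prednK ?size_poly_gt0 //.
  by rewrite leq_addr.
rewrite hornerC -mulr_natr mulf_neq0 ?lead_coef_eq0 //.
by rewrite char0 -lt0n fact_gt0.
Qed.

Lemma derivn_simple_root (R : idomainType) (p : {poly R}) x :
  [pchar R] =i pred0 -> p != 0 -> p.[x] = 0 ->
  exists j, p^`(j).[x] = 0 /\ p^`(j.+1).[x] != 0.
Proof.
move=> char0 p0 px; have ex_j := derivn_nonroot x char0 p0.
case: (ex_minnP ex_j) => -[|j] pj jmin.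
  by rewrite /= px eqxx in pj.
exists j; split=> //; apply/eqP; apply: contraTT (ltnSn j) => /jmin.
by rewrite -leqNgt.
Qed.

Lemma size_polyD_leq (R : nzSemiRingType) (p q : {poly R}) k :
  (size p <= k)%N -> (size q <= k)%N -> (size (p + q)%R <= k)%N.
Proof. by move=> pk qk; rewrite (leq_trans (size_polyD _ _)) // geq_max pk. Qed.

Lemma size_polyM_leqS (R : nzSemiRingType) (p q : {poly R}) i j :
  (size p <= i.+1)%N -> (size q <= j.+1)%N -> (size (p * q)%R <= (i + j).+1)%N.
Proof. by have := size_polyMleq p q; lia. Qed.

Lemma size_polyXn_leqS (R : nzSemiRingType) (p : {poly R}) i m :
  (size p <= i.+1)%N -> (size (p ^+ m)%R <= (i * m).+1)%N.
Proof.
move=> pi; apply: leq_trans (size_poly_exp_leq _ _) _.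
by rewrite ltnS leq_mul2r; apply/orP; right; lia.
Qed.

Section NewtonMap.
Variables (R : idomainType) (c y : R) (p : {poly R}).

Definition newton_map : {poly R} := 'X - c%:P * (p \Po ('X + y%:P)).

Lemma horner_newton_map x : newton_map.[x] = x - c * p.[x + y].
Proof.
rewrite hornerD hornerN hornerM hornerX hornerC horner_comp hornerD hornerX.
by rewrite hornerC.
Qed.

Lemma coef0_newton_map : newton_map`_0 = - (c * p.[y]).
Proof. by rewrite -horner_coef0 horner_newton_map add0r add0r. Qed.

Lemma coef1_newton_map : newton_map`_1 = 1 - c * p^`().[y].
Proof.
have -> : newton_map`_1 = newton_map^`()`_0 by rewrite coef_deriv.
rewrite -horner_coef0 derivB derivX deriv_mulC deriv_comp derivD derivX derivC.
by rewrite addr0 mulr1 !hornerE horner_comp !hornerE.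
Qed.

Lemma size_newton_map k : (0 < k)%N -> (size p <= k.+1)%N ->
  (size newton_map <= k.+1)%N.
Proof.
move=> k0 pk; apply: size_polyD_leq; first by rewrite size_polyX.
rewrite size_polyN (size_polyM_leqS (i := 0)) ?size_polyC_leq1 //.
by rewrite size_comp_poly2 ?size_XaddC.
Qed.

End NewtonMap.

(** * Polynomials in several variables *)

Lemma rmorph_mmap (n : nat) (R : nzRingType) (S T : comNzRingType)
    (rho : {rmorphism S -> T}) (f : R -> S) (h : 'I_n -> S) p :
  rho (mmap f h p) = mmap (rho \o f) (rho \o h) p.
Proof.
rewrite /mmap rmorph_sum; apply: eq_bigr => m _; rewrite rmorphM; congr (_ * _).
by rewrite /mmap1 rmorph_prod; apply: eq_bigr => i _; rewrite rmorphXn.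
Qed.

Lemma eq_mmap (n : nat) (R S : nzRingType) (f f' : R -> S) (h h' : 'I_n -> S) :
  f =1 f' -> h =1 h' -> mmap f h =1 mmap f' h'.
Proof.
move=> ef eh p; apply: eq_bigr => m _; rewrite ef; congr (_ * _).
exact: mmap1_eq.
Qed.

Lemma mmap_id (n : nat) (R : nzRingType) (p : {mpoly R[n]}) :
  mmap (@mpolyC n R) (fun i => 'X_i) p = p.
Proof.
by rewrite -[RHS]comp_mpoly_id; apply: eq_mmap => // i; rewrite tnth_mktuple.
Qed.

Section Univariate.
Variables (n : nat) (R : comNzRingType).
Implicit Type p : {mpoly R[n.+1]}.

Definition ord_rcons (T : Type) (h : 'I_n -> T) (y : T) (i : 'I_n.+1) : T :=
  if unlift ord_max i is Some j then h j else y.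

Lemma muni_mmap p : muni p =
  mmap (polyC \o @mpolyC n R) (ord_rcons (fun j => ('X_j)%:P) 'X) p.
Proof.
apply: eq_mmap => // i; rewrite /ord_rcons; case: splitP => [j|j] /= ij.
  have -> : i = lift ord_max j by apply: ord_inj; rewrite lift_max -ij.
  by rewrite liftK.
have -> : i = ord_max by apply: val_inj; rewrite /= ij ord1 addn0.
by rewrite unlift_none.
Qed.

Lemma horner_muni p y : (muni p).[y] =
  mmap (@mpolyC n R) (ord_rcons (fun j => 'X_j) y) p.
Proof.
rewrite muni_mmap -/(horner_eval y _) rmorph_mmap; apply: eq_mmap => [a|i].
  by rewrite /= /horner_eval hornerC.
rewrite /= /horner_eval /ord_rcons; case: unlift => [j|].
  by rewrite hornerC.
by rewrite hornerX.
Qed.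

Lemma comp_mpoly_rcons p (f : {mpoly R[n]}) :
  p \mPo [tuple of rcons [tuple 'X_i | i < n] f] = (muni p).[f].
Proof.
rewrite horner_muni; apply: eq_mmap => // i; rewrite (tnth_nth 0) nth_rcons.
rewrite size_tuple /ord_rcons; case: unliftP => [k|] ->.
  by rewrite lift_max ltn_ord -tnth_nth tnth_mktuple.
by rewrite /= ltnn eqxx.
Qed.

Lemma muni_inj : injective (@muni n R).
Proof.
move=> p q pq; suff muniK p' : (map_poly (mmap (@mpolyC n.+1 R)
    (fun j : 'I_n => 'X_(lift ord_max j))) (muni p')).['X_ord_max] = p'.
  by rewrite -[p]muniK pq muniK.
rewrite -/(horner_eval 'X_ord_max _) muni_mmap.
rewrite (rmorph_mmap (map_poly _)) rmorph_mmap -[RHS]mmap_id.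
apply: eq_mmap => [a|i] /=.
  by rewrite map_polyC /horner_eval hornerC /= mmapC.
rewrite /ord_rcons; case: unliftP => [j|] -> /=.
  by rewrite map_polyC /horner_eval hornerC /= mmapX mmap1U.
by rewrite map_polyX /horner_eval hornerX.
Qed.

Lemma muni_eq0 p : (muni p == 0) = (p == 0).
Proof. by rewrite -(muni0 n R) (inj_eq muni_inj). Qed.

Lemma muni_root_msize p y : p != 0 -> (muni p).[y] = 0 -> (1 < msize p)%N.
Proof.
move=> p0; apply: contra_eqT; rewrite -leqNgt => /msize1_polyC pC.
by rewrite pC muniC hornerC mpolyC_eq0 -(mpolyC_eq0 n.+1) -pC.
Qed.

Lemma coef_muni p i : (muni p)`_i = \sum_(m <- msupp p | m ord_max == i)
  p@_m *: 'X_[[multinom (m (widen_ord (leqnSn n) j)) | j < n]].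
Proof.
rewrite muniE coef_sum [RHS]big_mkcond; apply: eq_bigr => m _ /=.
rewrite coefZ coefXn eq_sym; case: eqP => _; first by rewrite mulr1.
by rewrite mulr0.
Qed.

Lemma mdeg_widen (m : 'X_{1..n.+1}) : mdeg m =
  (mdeg [multinom (m (widen_ord (leqnSn n) j)) | j < n] + m ord_max)%N.
Proof.
rewrite !mdegE big_ord_recr /=; congr (_ + _)%N.
by apply: eq_bigr => j _; rewrite mnmE.
Qed.

Lemma size_muni p : (size (muni p) <= msize p)%N.
Proof.
apply/leq_sizeP => i pi; rewrite coef_muni big_seq_cond big1 // => m.
case/andP => /msize_mdeg_lt + /eqP mi; rewrite mdeg_widen mi; lia.
Qed.

Lemma msize_coef_muni p i : (msize (muni p)`_i <= msize p)%N.
Proof.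
rewrite coef_muni; apply: leq_trans (msize_sum _ _ _) _.
apply/bigmax_leqP_seq => m mp _; apply: leq_trans (msizeZ_le _ _) _.
by rewrite msizeX; have := msize_mdeg_lt mp; rewrite mdeg_widen; lia.
Qed.

Lemma msize_horner_mpolyC (p : {poly {mpoly R[n]}}) c k :
  (forall i, msize p`_i <= k)%N -> (msize p.[c%:MP] <= k)%N.
Proof.
move=> pk; rewrite horner_coef; apply: leq_trans (msize_sum _ _ _) _.
apply/bigmax_leqP_seq => i _ _; rewrite -rmorphXn mulrC mul_mpolyC.
exact: leq_trans (msizeZ_le _ _) (pk i).
Qed.

End Univariate.

Lemma mpoly_nonroot (F : fieldType) n (p : {mpoly F[n]}) :
  [pchar F] =i pred0 -> p != 0 -> exists a, p.@[a] != 0.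
Proof.
move=> char0; elim: n p => [|n IH] p p0.
  exists (fun=> 0); move: p0; rewrite (nvar0_mpolyC p) mevalC.
  by apply: contraNneq => ->.
have [|a lc_a] := IH (lead_coef (muni p)).
  by rewrite lead_coef_eq0 muni_eq0.
pose q := map_poly (meval a) (muni p).
have /existsP[k qk] : [exists k : 'I_(size q), q.[k%:R] != 0].
  apply: contraR lc_a; rewrite negb_exists => /forallP q0.
  suff q_eq0 : q = 0 by rewrite /lead_coef -coef_map -/q q_eq0 coef0.
  apply: (poly_eq0_nodes (natr_inj char0) (leqnn _)) => k.
  by apply/eqP; rewrite -[_ == _]negbK.
exists (ord_rcons a k%:R); suff <- : q.[k%:R] = p.@[ord_rcons a k%:R] by [].
rewrite -(rmorph_nat (meval a)) horner_map horner_muni /= rmorph_mmap.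
apply: eq_mmap => [b|i] /=; first by rewrite mevalC.
by rewrite /ord_rcons; case: unlift => [j|]; rewrite ?mevalXU ?rmorph_nat.
Qed.

Section Homothety.
Variables (F : fieldType) (n : nat) (a : 'I_n -> F).
Local Notation A := {mpoly F[n]}.

Definition homothety : A -> {poly A} :=
  mmap (polyC \o @mpolyC n F)
    (fun i => (a i)%:MP%:P + 'X * ('X_i - (a i)%:MP)%:P).

HB.instance Definition _ := GRing.RMorphism.on homothety.

Lemma homothetyC c : homothety c%:MP = c%:MP%:P.
Proof. by rewrite /homothety mmapC. Qed.

Lemma horner_homothety x p : (homothety p).[x] =
  mmap (@mpolyC n F) (fun i => (a i)%:MP + x * ('X_i - (a i)%:MP)) p.
Proof.
rewrite -/(horner_eval x _) rmorph_mmap; apply: eq_mmap => [c|i] /=.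
  by rewrite /horner_eval hornerC.
by rewrite /horner_eval hornerD hornerM !hornerC hornerX.
Qed.

Lemma homothety1 p : (homothety p).[1] = p.
Proof.
rewrite horner_homothety -[RHS]mmap_id; apply: eq_mmap => // i.
by rewrite mul1r addrC subrK.
Qed.

Lemma homothety0 p : (homothety p).[0] = p.@[a]%:MP.
Proof.
rewrite horner_homothety rmorph_mmap; apply: eq_mmap => // i.
by rewrite mul0r addr0.
Qed.

Lemma size_homothety p : (size (homothety p) <= msize p)%N.
Proof.
apply: leq_trans (size_sum _ _ _) _; apply/bigmax_leqP_seq => m mp _.
apply: leq_trans (msize_mdeg_lt mp).
apply: (size_polyM_leqS (i := 0) (j := mdeg m)); first exact: size_polyC_leq1.
rewrite mdegE /mmap1; elim/big_rec2: _ => [|i u k _ IH].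
  by rewrite size_poly1.
apply: size_polyM_leqS => //; rewrite -[X in (_ <= X.+1)%N]mul1n.
apply: size_polyXn_leqS; apply: size_polyD_leq.
  by rewrite (leq_trans (size_polyC_leq1 _)).
rewrite (size_polyM_leqS (i := 1) (j := 0)) ?size_polyX //.
exact: size_polyC_leq1.
Qed.

Lemma coef0_map_homothety (p : {poly A}) f :
  (map_poly homothety p).[(f.@[a])%:MP%:P]`_0 = (p.[f]).@[a]%:MP.
Proof.
rewrite -[RHS]homothety0 -horner_coef0 -!/(horner_eval 0 _) -horner_map.
rewrite -[homothety _]horner_map -[RHS]horner_map /=; congr horner.
by rewrite /horner_eval hornerC homothety0.
Qed.

End Homothety.

(** * A formula for a root *)

Lemma mpoly_natr_unit (F : fieldType) n m :
  [pchar F] =i pred0 -> m.+1%:R \is a @GRing.unit {mpoly F[n]}.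
Proof.
move=> /pcharf0P char0; rewrite -(rmorph_nat (@mpolyC n F)) rmorph_unit //.
by rewrite unitfE char0.
Qed.

Section Slice.
Variables (F : fieldType) (n : nat) (P : {mpoly F[n.+1]}) (a : 'I_n -> F).

(* [P (l x + (1 - l) a, k)] *)
Definition slice (l k : nat) : {mpoly F[n]} :=
  (homothety a (muni P).[k%:R]).[l%:R].

(* Multiples by the natural number [l] are obtained with [l] parallel wires. *)
Definition slice_leaves (l k : nat) : 'I_n.+1 -> seq {mpoly F[n]} :=
  ord_rcons (fun i => rcons (nseq l 'X_i) (a i * (1 - l%:R))%:MP) [:: k%:R%:MP].

Lemma slice_mmap l k : slice l k =
  mmap (@mpolyC n F) (fun i => \sum_(u <- slice_leaves l k i) u) P.
Proof.
rewrite /slice horner_muni horner_homothety rmorph_mmap.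
apply: eq_mmap => [c|i]; first by rewrite /= mmapC.
rewrite /= /slice_leaves /ord_rcons; case: unlift => [j|]; last first.
  by rewrite big_seq1 !rmorph_nat.
rewrite mmapX mmap1U big_rcons big_nseq /= iter_addr addr0.
by rewrite mpolyCM mpolyCB mpolyC1 mpolyC_nat -mulr_natl; ring.
Qed.

End Slice.

Section RootFormula.
Variables (F : fieldType) (n r d : nat).
Variables (P : {mpoly F[n.+1]}) (f : {mpoly F[n]}).
Hypothesis char0 : [pchar F] =i pred0.
Hypotheses (r_gt0 : (0 < r)%N) (P_size : (msize P <= r.+1)%N).
Hypothesis f_size : (msize f <= d.+1)%N.
Variables (a : 'I_n -> F) (j : nat).
Local Notation A := {mpoly F[n]}.
Let Q := (muni P)^`(j).
Let y0 := f.@[a].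
Let q := (Q^`().[f]).@[a].
Hypotheses (Q_root : Q.[f] = 0) (q_neq0 : q != 0).

Let g := homothety a f - y0%:MP%:P.
Let phi := newton_map (q^-1)%:MP%:P y0%:MP%:P (map_poly (homothety a) Q).
Local Notation N := (2 * d).+1.
Local Notation D := (r * N).+1.

Lemma phi_fixed : phi.[g] = g.
Proof.
by rewrite horner_newton_map subrK horner_map Q_root rmorph0 mulr0 subr0.
Qed.

Lemma coef00_phi : phi`_0`_0 = 0.
Proof.
rewrite coef0_newton_map coefN coefCM coef0_map_homothety Q_root.
by rewrite meval0 mpolyC0 mulr0 oppr0.
Qed.

Lemma coef10_phi : phi`_1`_0 = 0.
Proof.
rewrite coef1_newton_map deriv_map coefB coef1 coefCM coef0_map_homothety.
by rewrite -mpolyCM mulVf // mpolyC1 subrr.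
Qed.

Lemma coef0_g : g`_0 = 0.
Proof.
by rewrite /g -horner_coef0 hornerD hornerN hornerC homothety0 subrr.
Qed.

Lemma size_g : (size g <= d.+1)%N.
Proof.
apply: size_polyD_leq; first exact: leq_trans (size_homothety _ _) f_size.
by rewrite size_polyN (leq_trans (size_polyC_leq1 _)).
Qed.

Lemma size_muni_P : (size (muni P) <= r.+1)%N.
Proof. exact: leq_trans (size_muni P) P_size. Qed.

Lemma size_phi : (size phi <= r.+1)%N.
Proof.
apply: size_newton_map => //; apply: leq_trans (size_poly _ _) _.
apply/leq_sizeP => i ri; rewrite coef_derivn nth_default ?mul0rn //.
by rewrite (leq_trans size_muni_P) // (leq_trans ri) ?leq_addl.
Qed.

Lemma horner_phi k :
  phi.[k%:R] = k%:R - (q^-1)%:MP%:P * homothety a Q.[(k%:R + y0)%:MP].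
Proof.
rewrite horner_newton_map -horner_map /= homothetyC.
by rewrite mpolyCD polyCD mpolyC_nat polyC_natr.
Qed.

Lemma size_horner_phi (k : nat) : (size phi.[k%:R] <= r.+1)%N.
Proof.
rewrite horner_phi; apply: size_polyD_leq.
  by rewrite -polyC_natr (leq_trans (size_polyC_leq1 _)).
rewrite size_polyN (size_polyM_leqS (i := 0)) ?size_polyC_leq1 //.
apply: leq_trans (size_homothety _ _) _; apply: msize_horner_mpolyC => i.
rewrite coef_derivn -scaler_nat.
by rewrite (leq_trans (msizeZ_le _ _)) // (leq_trans (msize_coef_muni _ _)).
Qed.

Definition sample_weight (k : nat) (i : 'I_r.+1) : F :=
  - (q^-1 * (lagrange_nat F i)^`(j).[k%:R + y0]).

Definition newton_sample (k l : nat) : A :=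
  k%:R%:MP + \sum_(i < r.+1) sample_weight k i *: slice P a l i.

Lemma newton_sampleE k l : phi.[k%:R].[l%:R] = newton_sample k l.
Proof.
rewrite /newton_sample horner_phi.
rewrite (horner_derivn_interpolation (@mpolyC n F) char0 _ _ size_muni_P).
rewrite hornerD hornerN hornerM hornerC -polyC_natr hornerC mpolyC_nat.
rewrite rmorph_sum horner_sum mulr_sumr -sumrN; congr (_ + _).
apply: eq_bigr => i _; rewrite rmorphM /= homothetyC hornerM hornerC.
by rewrite -mul_mpolyC mpolyCN mpolyCM /slice; ring.
Qed.

Definition root_weight (u : 'I_N * 'I_D * 'I_D) : F :=
  u.1.1.+1%:R^-1 * (lagrange_nat F u.1.2)`_u.1.1 *
  \sum_(i < d.+1) (lagrange_nat F u.2)`_i.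

Lemma coef_g i : (i <= d)%N -> g`_i = \sum_(m < N) \sum_(k < D) \sum_(l < D)
  (m.+1%:R^-1 * (lagrange_nat F k)`_m * (lagrange_nat F l)`_i) *:
    newton_sample k l ^+ m.+1.
Proof.
move=> le_id; have natr_unit m := mpoly_natr_unit n m char0.
have := lagrange_inversion natr_unit coef00_phi coef10_phi phi_fixed coef0_g.
move=> /(_ d N (leqnn N) i le_id)/eqP; rewrite coefB subr_eq0 => /eqP ->.
rewrite coef_sum; apply: eq_bigr => m _; rewrite coefZ.
have rmD : ((r * m.+1).+1 <= D)%N by rewrite ltnS leq_mul2l ltn_ord orbT.
rewrite (@coef_interpolation2 _ _ (@mpolyC n F) D _ _ _ char0); first last.
- move=> k; rewrite horner_exp.
  by rewrite (leq_trans (size_polyXn_leqS _ (size_horner_phi k))).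
- by rewrite (leq_trans (size_polyXn_leqS _ size_phi)).
rewrite mulr_sumr; apply: eq_bigr => k _.
rewrite mulr_sumr; apply: eq_bigr => l _.
rewrite !horner_exp newton_sampleE -mul_mpolyC -(rmorph_nat (@mpolyC n F)).
by rewrite -fmorphV mulrA -rmorphM mulrA.
Qed.

Lemma root_formula : f = y0%:MP + \sum_(u : 'I_N * 'I_D * 'I_D)
  root_weight u *: newton_sample u.1.2 u.2 ^+ u.1.1.+1.
Proof.
have -> : f = y0%:MP + g.[1].
  by rewrite /g hornerD hornerN hornerC homothety1 addrC subrK.
congr (_ + _); rewrite (horner_coef_wide _ size_g).
under eq_bigr => i _ do rewrite expr1n mulr1 coef_g -1?ltnS //.
rewrite exchange_big -(pair_bigA _ (fun mk l => root_weight (mk, l) *: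
  newton_sample mk.2 l ^+ mk.1.+1)) /=.
rewrite -(pair_bigA _ (fun m k => \sum_l root_weight (m, k, l) *:
  newton_sample k l ^+ m.+1)) /=.
apply: eq_bigr => m _; rewrite exchange_big; apply: eq_bigr => k _.
rewrite exchange_big; apply: eq_bigr => l _ /=.
by rewrite -scaler_suml -mulr_sumr.
Qed.

End RootFormula.

(** * Families of polynomials computed in layers *)

Definition gate_op (R : comNzRingType) (b : bool) (s : seq R) : R :=
  if b then \prod_(y <- s) y else \sum_(y <- s) y.

Lemma gate_op_flatten (R : comNzRingType) b (ss : seq (seq R)) :
  gate_op b (flatten ss) = gate_op b (map (gate_op b) ss).
Proof. by case: b; rewrite /gate_op big_map big_flatten. Qed.

Lemma gate_op1 (R : comNzRingType) b (x : R) : gate_op b [:: x] = x.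
Proof. by case: b; rewrite /gate_op big_seq1. Qed.

Lemma map_eq_nil (T U : eqType) (f : T -> U) (s : seq T) :
  (map f s == [::]) = (s == [::]).
Proof. by case: s. Qed.

Lemma size_flatten_leq (T : Type) (ss : seq (seq T)) K :
  all (fun s => size s <= K)%N ss -> (size (flatten ss) <= size ss * K)%N.
Proof.
elim: ss => //= s ss IH /andP[sK /IH ssK].
by rewrite size_cat mulSn leq_add.
Qed.

Lemma flatten_map_flatten (T U : Type) (f : T -> seq U) (sss : seq (seq T)) :
  flatten [seq flatten (map f ss) | ss <- sss] = flatten (map f (flatten sss)).
Proof. by elim: sss => //= ss sss ->; rewrite map_cat flatten_cat. Qed.

Lemma size_leq_flatten (T : eqType) (ss : seq (seq T)) s :
  s \in ss -> (size s <= size (flatten ss))%N.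
Proof.
elim: ss => //= t ss IH; rewrite inE size_cat => /predU1P[->|/IH ss_s].
  exact: leq_addr.
by rewrite (leq_trans ss_s) ?leq_addl.
Qed.

Lemma size_leq_size_flatten (T : eqType) (ss : seq (seq T)) :
  [::] \notin ss -> (size ss <= size (flatten ss))%N.
Proof.
elim: ss => //= -[|x s] ss IH; rewrite inE //= => /IH ss_s.
by rewrite ltnS size_cat (leq_trans ss_s) ?leq_addl.
Qed.

Lemma size_flatten_map_cons (T : Type) (x : T) (ss : seq (seq T)) :
  size (flatten (map (cons x) ss)) = (size ss + size (flatten ss))%N.
Proof. by elim: ss => //= s ss IH; rewrite !size_cat IH; lia. Qed.

Lemma all_map_preim (T U : eqType) (f : T -> U) (P : pred T) (s : seq U) :
  {in s, forall y, exists2 x, P x & f x = y} ->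
  exists2 r, all P r & map f r = s.
Proof.
elim: s => [|y s IH] sP; first by exists [::].
have [x Px xy] := sP y (mem_head _ _).
have [|r Pr <-] := IH; first by move=> z zs; apply: sP; rewrite inE zs orbT.
by exists (x :: r); rewrite /= ?Px ?xy.
Qed.

Section Operands.
Variables (F : fieldType) (m : nat).
Implicit Types (p : {mpoly F[m]}) (V W : seq {mpoly F[m]}).

Definition leaf p : bool := (p == (p@_0)%:MP) || [exists i, p == 'X_i].

Lemma leafC a : leaf a%:MP.
Proof. by rewrite /leaf mcoeffC eqxx mulr1 eqxx. Qed.

Lemma leafX i : leaf 'X_i.
Proof. by apply/orP; right; apply/existsP; exists i. Qed.

Definition operand W p : bool := leaf p || (p \in W).

Lemma operandS V W : {subset V <= W} -> subpred (operand V) (operand W).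
Proof. by move=> VW p /orP[lp|/VW Wp]; apply/orP; [left | right]. Qed.

Lemma operand_leaf W p : leaf p -> operand W p.
Proof. by move=> lp; apply/orP; left. Qed.

Lemma operand_mem W p : p \in W -> operand W p.
Proof. by move=> pW; apply/orP; right. Qed.

End Operands.

Arguments leaf {F m} p.
Arguments operand {F m} W p.

Lemma operands_map (F : fieldType) m n (h : {mpoly F[m]} -> {mpoly F[n]}) W g :
  all (operand W) g ->
  all (operand (map h (W ++ [seq q <- g | leaf q]))) (map h g).
Proof.
move=> ops; rewrite all_map; apply/allP => q qg /=; apply/operand_mem/map_f.
by rewrite mem_cat mem_filter qg andbT orbC; apply: (allP ops).
Qed.

Section Computable.
Variables (F : fieldType) (m : nat).
Implicit Types (p : {mpoly F[m]}) (g V W : seq {mpoly F[m]}) (b : bool).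

(* The values of the gates of one layer, of product gates if [b] and of sum
   gates otherwise, above at most [D - 1] further alternating layers with at
   most [S] wires in all.  A gate is the nonempty list of its operands; gates
   are identified with their values, so that layers may be merged freely. *)
Fixpoint computable b D S V : Prop :=
  if D is D'.+1 then
    exists (gates : seq (seq {mpoly F[m]})) W S',
      [/\ V = map (gate_op b) gates, [::] \notin gates,
          all (operand W) (flatten gates), computable (~~ b) D' S' W &
          (size (flatten gates) + S' <= S)%N]
  else V = [::].

Arguments computable : simpl never.

Lemma computable_nil b D S : computable b D S [::].
Proof. by elim: D b S => //= D IH b S; exists [::], [::], 0%N. Qed.

Lemma computableW b D D' S S' V : (D <= D')%N -> (S <= S')%N ->
  computable b D S V -> computable b D' S' V.
Proof.
elim: D b D' S S' V => [|D IH] b [|D'] S S' V //.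
  by move=> _ _ ->; apply: computable_nil.
move=> DD' SS' [gates [W [S1 [-> ne ops cW sz]]]].
exists gates, W, S1; split=> //; first exact: IH cW.
exact: leq_trans sz SS'.
Qed.

Lemma computable_gate b D S W g :
  g != [::] -> all (operand W) g -> computable b D S W ->
  computable (~~ b) D.+1 (size g + S) [:: gate_op (~~ b) g].
Proof.
move=> g0 ops cW; exists [:: g], W, S.
by rewrite negbK /= cats0 inE eq_sym.
Qed.

Lemma computable_leaves b D g :
  g != [::] -> all leaf g -> computable b D.+1 (size g) [:: gate_op b g].
Proof.
move=> g0 lg; rewrite -[b]negbK -[X in computable _ _ X _]addn0.
apply: (@computable_gate _ _ _ [::]) => //; last exact: computable_nil.
exact: sub_all (@operand_leaf _ _ _) _ lg.
Qed.

Lemma computable_leaf b D p : leaf p -> computable b D.+1 1 [:: p].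
Proof.
move=> lp; rewrite -[p](gate_op1 b).
by apply: (@computable_leaves _ _ [:: p]); rewrite /= ?lp.
Qed.

Lemma computable_cat b D S1 S2 V1 V2 : computable b D S1 V1 ->
  computable b D S2 V2 -> computable b D (S1 + S2) (V1 ++ V2).
Proof.
elim: D b S1 S2 V1 V2 => [|D IH] b S1 S2 V1 V2; first by move=> -> ->.
move=> [gs1 [W1 [T1 [-> ne1 ops1 c1 sz1]]]].
move=> [gs2 [W2 [T2 [-> ne2 ops2 c2 sz2]]]].
exists (gs1 ++ gs2), (W1 ++ W2), (T1 + T2)%N; split; first by rewrite map_cat.
- by rewrite mem_cat negb_or ne1.
- rewrite flatten_cat all_cat; apply/andP; split.
    by apply: sub_all ops1; apply: operandS => p; rewrite mem_cat => ->.
  by apply: sub_all ops2; apply: operandS => p; rewrite mem_cat orbC => ->.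
- exact: IH.
by rewrite flatten_cat size_cat addnACA leq_add.
Qed.

Lemma computable_map (I : eqType) b D S (r : seq I) (p : I -> {mpoly F[m]}) :
  {in r, forall i, computable b D S [:: p i]} ->
  computable b D (size r * S) (map p r).
Proof.
elim: r => [|i r IH] cp; first exact: computable_nil.
rewrite mulSn -cat1s map_cat; apply: computable_cat; first exact/cp/mem_head.
by apply: IH => j jr; apply: cp; rewrite inE jr orbT.
Qed.

Lemma computable_mem b D S V p :
  p \in V -> computable b D S V -> computable b D S [:: p].
Proof.
case: D => [|D] pV; first by move=> V0; rewrite V0 in pV.
move=> [gates [W [S' [VE ne ops cW sz]]]]; move: pV.
rewrite VE => /mapP[g gG ->]; exists [:: g], W, S'; split=> //.
- by rewrite inE; apply: contraNneq ne => ->.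
- apply/allP => q; rewrite /= cats0 => qg; apply: (allP ops).
  by apply/flattenP; exists g.
by apply: leq_trans sz; rewrite leq_add2r /= cats0 size_leq_flatten.
Qed.

(* The gates of a layer are merged into one by flattening their operands. *)
Lemma computable_gate_op b D S V :
  V != [::] -> computable b D S V -> computable b D S [:: gate_op b V].
Proof.
case: D => [|D] V0; first by move=> VE; rewrite VE in V0.
move=> [gates [W [S' [VE ne ops cW sz]]]]; exists [:: flatten gates], W, S'.
rewrite VE -gate_op_flatten /= cats0; split=> //; rewrite inE eq_sym.
apply: contraNneq V0; rewrite VE; case: gates ne {VE ops sz} => // g gates.
by rewrite inE negb_or => /andP[]; case: g.
Qed.

Lemma computable_prodZ D S a W : computable true D.+1 S W ->
  computable true D.+1 (2 * S) (map ( *:%R a) W).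
Proof.
move=> [gates [V [S' [-> ne ops cV sz]]]].
exists (map (cons a%:MP) gates), V, S'; split=> //.
- rewrite -!map_comp; apply: eq_map => g.
  by rewrite /gate_op /= big_cons mul_mpolyC.
- by apply/mapP => -[].
- apply/allP => q /flattenP[_ /mapP[g gG ->]]; rewrite inE.
  case/predU1P => [->|qg]; first exact/operand_leaf/leafC.
  by apply: (allP ops); apply/flattenP; exists g.
have sg : (size gates <= size (flatten gates))%N := size_leq_size_flatten ne.
by rewrite size_flatten_map_cons; lia.
Qed.

(* A sum is scaled by scaling its operands, the leaves among them becoming
   product gates. *)
Lemma computableZ D S a V : computable false D.+2 S V ->
  computable false D.+2 (3 * S) (map ( *:%R a) V).
Proof.
move=> [gates [W [S' [-> ne ops cW sz]]]].
pose inputs := [seq q <- flatten gates | leaf q].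
have cinputs : computable true D.+1 (size inputs * 2) (map ( *:%R a) inputs).
  apply: computable_map => q; rewrite mem_filter => /andP[lq _].
  have -> : a *: q = gate_op true [:: a%:MP; q].
    by rewrite /gate_op big_cons big_seq1 mul_mpolyC.
  by apply: computable_leaves; rewrite /= ?leafC ?lq.
have sinputs : (size inputs <= size (flatten gates))%N.
  by rewrite size_filter count_size.
exists [seq map ( *:%R a) g | g <- gates], (map ( *:%R a) (W ++ inputs)).
exists (2 * S' + size inputs * 2)%N; split.
- rewrite -!map_comp; apply: eq_map => g /=.
  by rewrite /gate_op big_map scaler_sumr.
- by apply: contra ne => /mapP[[|? ?]].
- by rewrite -map_flatten; apply: operands_map.
- by rewrite map_cat; apply: computable_cat cinputs; apply: computable_prodZ.
have -> : size (flatten [seq map ( *:%R a) g | g <- gates]) =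
          size (flatten gates) by rewrite -map_flatten size_map.
by lia.
Qed.

End Computable.

Section Substitution.
Variables (F : fieldType) (m n : nat).
Variables (ell : 'I_m -> seq {mpoly F[n]}) (K : nat).
Hypothesis ell_leaf : forall i, all leaf (ell i).
Hypothesis size_ell : forall i, (0 < size (ell i) <= K)%N.
Hypothesis K_gt0 : (0 < K)%N.
Implicit Types (q : {mpoly F[m]}) (b : bool) (W : seq {mpoly F[m]}).

Local Notation sigma := (mmap (@mpolyC n F) (fun i => \sum_(u <- ell i) u)).

(* A gate is expanded as well if its value is a variable. *)
Definition expand q : seq {mpoly F[n]} :=
  if [pick i | q == 'X_i] is Some i then ell i else [:: sigma q].

Lemma sum_expand q : \sum_(u <- expand q) u = sigma q.
Proof.
rewrite /expand; case: pickP => [i /eqP->|_]; last by rewrite big_seq1.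
by rewrite mmapX mmap1U.
Qed.

Lemma size_expand q : (0 < size (expand q) <= K)%N.
Proof. by rewrite /expand; case: pickP => [i _|_] //=. Qed.

Lemma expand_leaf q : leaf q -> all leaf (expand q).
Proof.
rewrite /expand; case: pickP => [i _ _|nX] //= /orP[/eqP->|/existsP[i]].
  by rewrite mmapC leafC.
by rewrite nX.
Qed.

Lemma expand_operand W q :
  operand W q -> all (operand (map sigma W)) (expand q).
Proof.
case/orP => [/expand_leaf|qW]; first exact: sub_all (@operand_leaf _ _ _) _.
rewrite /expand; case: pickP => [i _|_] /=.
  exact: sub_all (@operand_leaf _ _ _) _ (ell_leaf i).
by rewrite operand_mem ?map_f.
Qed.

Lemma computable_expand_leaves D (g : seq {mpoly F[m]}) :
  all leaf g -> computable false D.+1 (size g * K) (map sigma g).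
Proof.
move=> /allP lg; apply: computable_map => q /lg lq.
have /andP[q0 qK] := size_expand q.
rewrite -sum_expand -[\sum_(u <- _) u]/(gate_op false _).
apply: computableW (@computable_leaves _ _ _ D _ _ (expand_leaf lq)) => //.
by rewrite -size_eq0 -lt0n.
Qed.

(* The sums replacing the variables are merged into the sum gates that the
   variables feed, and become new gates below product gates. *)
Lemma computable_subst b D S V : computable b D S V ->
  computable b D.+1 (S * K.+1) (map sigma V).
Proof.
elim: D b S V => [|D IH] b S V; first by move=> ->; apply: computable_nil.
move=> [gates [W [S' [-> ne ops /IH cW sz]]]]; case: b cW => cW.
  pose inputs := [seq q <- flatten gates | leaf q].
  have inputsK : (size inputs * K <= size (flatten gates) * K)%N.
    by rewrite leq_mul2r size_filter count_size orbT.
  exists (map (map sigma) gates), (map sigma (W ++ inputs)).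
  exists (S' * K.+1 + size inputs * K)%N; split.
  - rewrite -!map_comp; apply: eq_map => g.
    by rewrite /gate_op /= big_map rmorph_prod.
  - by apply: contra ne => /mapP[[|? ?]].
  - by rewrite -map_flatten; apply: operands_map.
  - rewrite map_cat; apply: computable_cat => //.
    by apply: computable_expand_leaves; apply: filter_all.
  rewrite -map_flatten size_map; apply: leq_trans (leq_mul sz (leqnn K.+1)).
  by rewrite mulnDl [leqRHS]addnC (mulnS (size _)) addnCA !leq_add2l.
exists [seq flatten (map expand g) | g <- gates], (map sigma W), (S' * K.+1)%N.
rewrite flatten_map_flatten; split=> //.
- rewrite -!map_comp; apply: eq_map => g /=.
  rewrite /gate_op rmorph_sum big_flatten big_map.
  by apply: eq_bigr => q _; rewrite sum_expand.
- apply: contra ne => /mapP[[|q g] gG //=].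
  by have := size_expand q; case: (expand q).
- apply/allP => u /flatten_mapP[q /(allP ops)/expand_operand].
  by move=> /allP opq /opq.
apply: leq_trans (leq_mul sz (leqnn K.+1)); rewrite mulnDl leq_add2r.
have size_expansions :
    all (fun t => size t <= K)%N (map expand (flatten gates)).
  by rewrite all_map; apply/allP => q _; have /andP[] := size_expand q.
apply: leq_trans (size_flatten_leq size_expansions) _.
by rewrite size_map leq_mul.
Qed.

End Substitution.

(** * From circuits to layers and back *)

Section OfCircuit.
Variables (F : fieldType) (m : nat) (c : circuit F m).
Variables (layer : cnode c -> nat) (v : cnode c -> {mpoly F[m]}).
Hypothesis layer_cout : layer (cout c) = 0%N.
Hypothesis layer_sum : forall x, clabel x = LSum -> ~~ odd (layer x).
Hypothesis layer_prod : forall x, clabel x = LProd -> odd (layer x).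
Hypothesis layer_fanin : forall x y : cnode c,
  y \in cfanin x -> ~~ is_input (clabel y) -> layer y = (layer x).+1.
Hypothesis v_val : valuation v.
Local Notation e := (grel (@cfanin F m c)).

Lemma path_to_input (x : cnode c) :
  exists2 p, path e x p & is_input (clabel (last x p)).
Proof.
elim/circuit_ind: x => x IH; have := c_input x.
case E : (cfanin x) => [|y s] /=; first by exists [::].
have [|p yp py] := IH y; first by rewrite E mem_head.
by exists (y :: p); rewrite //= E mem_head.
Qed.

Lemma layer_path p : path e (cout c) p ->
  ~~ is_input (clabel (last (cout c) p)) -> layer (last (cout c) p) = size p.
Proof.
elim/last_ind: p => [|p x IH] //; rewrite rcons_path last_rcons size_rcons.
move=> /andP[pp px] nx; rewrite (layer_fanin px nx) IH // -c_input.
by apply: contraL px => /nilP /= ->.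
Qed.

Definition live_gate (x : cnode c) : bool :=
  connect e (cout c) x && ~~ is_input (clabel x).

Lemma live_gate_fanin x y : live_gate x -> y \in cfanin x ->
  ~~ is_input (clabel y) -> live_gate y.
Proof.
move=> /andP[cx _] xy ny; rewrite /live_gate ny andbT.
exact: connect_trans cx (connect1 xy).
Qed.

Lemma layer_live_gate D x :
  depth_at_most c D -> live_gate x -> (layer x < D)%N.
Proof.
move=> cD /andP[/connectP[p cp xE] nx]; have [p' xp] := path_to_input x.
case: p' xp => [|y p'] xp ip; first by rewrite /= (negbTE nx) in ip.
rewrite xE layer_path -?xE //; have := cD (p ++ y :: p').
rewrite cat_path last_cat -xE cp => /(_ xp ip); apply: leq_trans.
by rewrite size_cat /= addnS ltnS leq_addr.
Qed.

Lemma value_input x : is_input (clabel x) -> leaf (v x).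
Proof.
rewrite v_val /gate_value; case: (clabel x) => // [a|i] _.
  exact: leafC.
exact: leafX.
Qed.

Lemma value_gate x : ~~ is_input (clabel x) ->
  v x = gate_op (odd (layer x)) (map v (cfanin x)).
Proof.
rewrite v_val /gate_value /gate_op; case E: (clabel x) => // _.
  by rewrite (negbTE (layer_sum E)) big_map.
by rewrite (layer_prod E) big_map.
Qed.

Definition layer_gates k : seq (cnode c) :=
  [seq x <- enum (cnode c) | live_gate x & layer x == k].

Lemma mem_layer_gates k x :
  (x \in layer_gates k) = live_gate x && (layer x == k).
Proof. by rewrite mem_filter mem_enum andbT. Qed.

Lemma computable_layer_gates D k j : depth_at_most c D -> (k + j = D)%N ->
  computable (odd k) j (\sum_(x | (k <= layer x)%N) size (cfanin x))
    (map v (layer_gates k)).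
Proof.
move=> cD; elim: j k => [|j IH] k kj.
  case E: (layer_gates k) => [|x s] //; have := mem_head x s.
  rewrite -E mem_layer_gates => /andP[/(layer_live_gate cD) + /eqP].
  by rewrite -kj addn0 => /[swap] ->; rewrite ltnn.
exists [seq map v (cfanin x) | x <- layer_gates k], (map v (layer_gates k.+1)).
exists (\sum_(x | (k < layer x)%N) size (cfanin x))%N; split.
- rewrite -map_comp; apply/eq_in_map => x; rewrite mem_layer_gates.
  by case/andP=> /andP[_ nx] /eqP <-; apply: value_gate.
- apply/mapP => -[x]; rewrite mem_layer_gates => /andP[/andP[_ nx] _] fx.
  by rewrite -c_input /nilp -(size_map v) -fx in nx.
- apply/allP => _ /flatten_mapP[x + /mapP[y xy ->]]; rewrite mem_layer_gates.
  case/andP => lx /eqP kx; have [iy|ny] := boolP (is_input (clabel y)).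
    exact/operand_leaf/value_input.
  apply/operand_mem/map_f; rewrite mem_layer_gates (live_gate_fanin lx) //=.
  by rewrite (layer_fanin xy) ?kx.
- by apply: (IH k.+1); rewrite addSnnS.
rewrite [leqRHS](bigID (fun x => layer x == k)) /=; apply: leq_add; last first.
  by apply: eq_leq; apply: eq_bigl => x; rewrite ltn_neqAle eq_sym andbC.
rewrite size_flatten /shape -map_comp sumnE big_map big_filter big_enum_cond /=.
rewrite [leqRHS](bigID live_gate) /=; apply: leq_trans (leq_addr _ _).
under eq_bigr do rewrite size_map.
apply: eq_leq; apply: eq_bigl => x; rewrite andbC.
by case: eqP => [->|]; rewrite ?leqnn ?andbF.
Qed.

End OfCircuit.

Lemma circuit_computable (F : fieldType) m (c : circuit F m) D p :
  computes c p -> depth_at_most c D -> computable false D (csize c) [:: p].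
Proof.
move=> [v v_val <-] cD; have [layer [l0 lS lP lf]] := c_layered c.
have := computable_layer_gates l0 lS lP lf v_val cD (add0n D).
apply: computable_mem; apply: map_f.
by rewrite mem_layer_gates /live_gate connect0 c_top l0.
Qed.

Section LayeredGraph.
Variables (F : fieldType) (m : nat).

Record layered_graph (b : bool) := LayeredGraph {
  vertex : finType;
  fanin : vertex -> seq vertex;
  level : vertex -> nat;
  value : vertex -> {mpoly F[m]};
  level_fanin : forall x y, y \in fanin x -> level y = (level x).+1;
  value_fanin : forall x, fanin x != [::] ->
    value x = gate_op (b (+) odd (level x)) (map value (fanin x));
  value_leaf : forall x, fanin x = [::] -> leaf (value x)
}.

Definition root b (G : layered_graph b) (x : vertex G) : bool :=
  (level x == 0%N) && (fanin x != [::]).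

Definition graph_size b (G : layered_graph b) : nat :=
  (\sum_(x : vertex G) size (fanin x))%N.

Definition graph_depth b (G : layered_graph b) (D : nat) : Prop :=
  forall x : vertex G, fanin x != [::] -> (level x < D)%N.

Definition empty_graph b : layered_graph b :=
  @LayeredGraph b void (fun=> [::]) (fun=> 0%N) (fun=> 0)
    (fun x => match x with end) (fun x => match x with end)
    (fun x => match x with end).

Section AddLayer.
Variables (b : bool) (G : layered_graph (~~ b)).
Variables (L : seq {mpoly F[m]}) (k : nat).
Hypothesis L_leaf : all leaf L.
Local Notation lower := (seq_sub L + vertex G)%type.

Definition lower_value (u : lower) : {mpoly F[m]} :=
  match u with inl l => ssval l | inr x => value x end.

Definition lower_root (u : lower) : bool :=
  if u is inr x then root x else true.

Variable ops : 'I_k -> seq lower.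
Hypothesis ops_neq0 : forall i, ops i != [::].
Hypothesis ops_root : forall i, all lower_root (ops i).
Local Notation node := ('I_k + lower)%type.

Definition add_fanin (x : node) : seq node :=
  match x with
  | inl i => map inr (ops i)
  | inr (inl _) => [::]
  | inr (inr x) => map (inr \o inr) (fanin x)
  end.

Definition add_level (x : node) : nat :=
  match x with
  | inl _ => 0
  | inr (inl _) => 1
  | inr (inr x) => (level x).+1
  end.

Definition add_value (x : node) : {mpoly F[m]} :=
  match x with
  | inl i => gate_op b (map lower_value (ops i))
  | inr u => lower_value u
  end.

Fact add_level_fanin x y : y \in add_fanin x -> add_level y = (add_level x).+1.
Proof.
case: x => [i|[l|x]] //= /mapP[u + ->] //=.
  by case: u => // x /(allP (ops_root i)) /andP[/eqP->].
by move=> /level_fanin ->.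
Qed.

Fact add_value_fanin x : add_fanin x != [::] ->
  add_value x = gate_op (b (+) odd (add_level x)) (map add_value (add_fanin x)).
Proof.
case: x => [i|[l|x]] //=; first by rewrite addbF -map_comp.
rewrite map_eq_nil => /value_fanin ->.
by rewrite -map_comp addbN addNb.
Qed.

Fact add_value_leaf x : add_fanin x = [::] -> leaf (add_value x).
Proof.
case: x => [i|[l|x]] /=.
- by move/eqP; rewrite map_eq_nil (negbTE (ops_neq0 i)).
- by move=> _; apply: (allP L_leaf); apply: ssvalP.
by move/eqP; rewrite map_eq_nil => /eqP/value_leaf.
Qed.

Definition add_layer : layered_graph b :=
  LayeredGraph add_level_fanin add_value_fanin add_value_leaf.

Lemma add_layer_size :
  graph_size add_layer = (\sum_i size (ops i) + graph_size G)%N.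
Proof.
rewrite /graph_size !big_sumType /=; congr addn.
  by apply: eq_bigr => i _; rewrite size_map.
by rewrite big1 // add0n; apply: eq_bigr => x _; rewrite size_map.
Qed.

Lemma add_layer_depth D : graph_depth G D -> graph_depth add_layer D.+1.
Proof.
by move=> GD [i|[l|x]] //=; rewrite map_eq_nil => /GD; rewrite ltnS.
Qed.

End AddLayer.

Lemma computable_graph b D S V : computable b D S V ->
  exists G : layered_graph b,
    [/\ graph_depth G D, (graph_size G <= S)%N &
        {in V, forall p, exists2 x : vertex G, root x & value x = p}].
Proof.
elim: D b S V => [|D IH] b S V.
  move=> ->; exists (empty_graph b).
  by split=> [[] | | p] //; rewrite /graph_size big1 // => -[].
move=> [gates [W [S' [-> ne ops /IH[G [GD GS GW]] sz]]]].
pose L := [seq q <- flatten gates | leaf q].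
have L_leaf : all leaf L by apply: filter_all.
have preim (i : 'I_(size gates)) : exists2 r : seq (seq_sub L + vertex G),
    all (@lower_root _ _ _) r & map (@lower_value _ _ _) r = nth [::] gates i.
  apply: all_map_preim => q qi.
  have qG : q \in flatten gates.
    by apply/flattenP; exists (nth [::] gates i); rewrite ?mem_nth.
  have /orP[lq|/GW[x rx <-]] := allP ops q qG; last by exists (inr x).
  have qL : q \in L by rewrite mem_filter lq.
  by exists (inl (SeqSub qL)).
have [u u_root uE] := fin_all_exists2 preim.
have u0 i : u i != [::].
  rewrite -(map_eq_nil (@lower_value _ _ _)) uE.
  by apply: contraNneq ne => <-; rewrite mem_nth.
exists (add_layer L_leaf u0 u_root); split.
- exact: add_layer_depth.
- rewrite add_layer_size; apply: leq_trans sz; apply: leq_add GS.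
  rewrite size_flatten /shape sumnE big_map (big_nth [::]) big_mkord.
  by apply: eq_leq; apply: eq_bigr => i _; rewrite -uE size_map.
move=> _ /mapP[g /(nthP [::])[i ig <-] ->].
exists (inl (Ordinal ig)); last by rewrite /= uE.
by rewrite /root /= map_eq_nil u0.
Qed.

Definition leaf_label (p : {mpoly F[m]}) : label F m :=
  if [pick i | p == 'X_i] is Some i then LVar i else LConst p@_0.

Section CircuitOfGraph.
Variables (G : layered_graph false) (r : vertex G).
Hypothesis r_root : root r.

Definition graph_label (x : vertex G) : label F m :=
  if nilp (fanin x) then leaf_label (value x)
  else if odd (level x) then LProd else LSum.

Fact graph_label_input x : nilp (fanin x) = is_input (graph_label x).
Proof.
rewrite /graph_label /leaf_label; case: ifP => _; last by case: ifP.
by case: pickP.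
Qed.

Lemma level_path x p :
  path (grel (@fanin _ G)) x p -> level (last x p) = (level x + size p)%N.
Proof.
elim: p x => [|y p IH] x /=; first by rewrite addn0.
by move=> /andP[/level_fanin xy /IH ->]; rewrite xy addSnnS.
Qed.

Fact graph_acyclic x y : y \in fanin x -> ~~ connect (grel (@fanin _ G)) y x.
Proof.
move=> /level_fanin xy; apply/negP => /connectP[p /level_path + xE].
by rewrite -xE xy => /eqP; rewrite addSn -addnS -[X in X == _]addn0 eqn_add2l.
Qed.

Fact graph_layered : exists layer : vertex G -> nat,
  [/\ layer r = 0%N,
      forall x, graph_label x = LSum -> ~~ odd (layer x),
      forall x, graph_label x = LProd -> odd (layer x) &
      forall x y, y \in fanin x -> ~~ is_input (graph_label y) ->
        layer y = (layer x).+1].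
Proof.
have labelP x : ~~ is_input (graph_label x) ->
    graph_label x = if odd (level x) then LProd else LSum.
  by rewrite -graph_label_input /graph_label => /negbTE ->.
exists (@level _ G); split=> [|x lx|x lx|x y /level_fanin //].
- by have /andP[/eqP r0 _] := r_root.
- by move: (labelP x); rewrite lx => /(_ isT); case: odd.
by move: (labelP x); rewrite lx => /(_ isT); case: odd.
Qed.

Fact graph_top : graph_label r = LSum.
Proof.
have /andP[/eqP r0 rs] := r_root.
by rewrite /graph_label /nilp size_eq0 (negbTE rs) r0.
Qed.

Definition circuit_of_graph : circuit F m :=
  Circuit graph_label_input graph_acyclic graph_layered graph_top.

Lemma circuit_of_graph_computes : computes circuit_of_graph (value r).
Proof.
exists (@value _ G) => // x; rewrite /gate_value /= /graph_label.
have [/nilP x0|x0] := ifPn.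
  have := value_leaf x0; rewrite /leaf_label /leaf.
  case: pickP => [i /eqP-> //|nX]; case/orP => [/eqP //|/existsP[i]].
  by rewrite nX.
rewrite value_fanin; last by rewrite -size_eq0.
by rewrite /gate_op /=; case: odd; rewrite big_map.
Qed.

Lemma circuit_of_graph_depth D :
  graph_depth G D -> depth_at_most circuit_of_graph D.
Proof.
move=> GD p rp _; have [/eqP r0 _] := andP r_root.
case/lastP: p rp => [//|p x]; rewrite rcons_path size_rcons => /andP[rp px].
have := level_path rp; rewrite r0 add0n => <-.
by apply: GD; apply: contraTneq px => /= ->.
Qed.

End CircuitOfGraph.

Lemma computable_circuit D S p : computable false D S [:: p] ->
  exists c : circuit F m,
    [/\ computes c p, depth_at_most c D & (csize c <= S)%N].
Proof.
move=> /computable_graph[G [GD GS /(_ p (mem_head _ _))[r r_root <-]]].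
exists (circuit_of_graph r_root); split=> //.
  exact: circuit_of_graph_computes.
exact: circuit_of_graph_depth.
Qed.

End LayeredGraph.

(** * The circuit of a root *)

Lemma csize_gt0 (F : fieldType) m (c : circuit F m) : (0 < csize c)%N.
Proof.
rewrite /csize (bigD1 (cout c)) //= addn_gt0 lt0n.
by have := c_input (cout c); rewrite c_top /nilp => /negbT ->.
Qed.

Section RootCircuit.
Variables (F : fieldType) (n r s Delta d : nat).
Variables (P : {mpoly F[n.+1]}) (f : {mpoly F[n]}) (a : 'I_n -> F).
Hypothesis cP : computable false Delta s [:: P].
Local Notation N := (2 * d).+1.
Local Notation D := (r * N).+1.

Lemma slice_leaves_leaf l k (i : 'I_n.+1) : all leaf (slice_leaves a l k i).
Proof.
rewrite /slice_leaves /ord_rcons; case: unlift => [j|] /=; last first.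
  by rewrite leafC.
by rewrite all_rcons leafC all_nseq leafX orbT.
Qed.

Lemma size_slice_leaves l k (i : 'I_n.+1) :
  (0 < size (slice_leaves a l k i) <= l.+1)%N.
Proof.
rewrite /slice_leaves /ord_rcons; case: unlift => [j|] //=.
by rewrite size_rcons size_nseq /=.
Qed.

Lemma computable_slice l k :
  computable false Delta.+1 (s * l.+2) [:: slice P a l k].
Proof.
rewrite slice_mmap; have ell_leaf := slice_leaves_leaf l k.
exact: (computable_subst ell_leaf (size_slice_leaves l k) isT cP).
Qed.

Definition sample_size : nat := (1 + r.+1 * (3 * (s * D.+1)))%N.

Lemma computable_sample j k l : (l < D)%N ->
  computable false Delta.+1 sample_size [:: newton_sample r P f a j k l].
Proof.
move=> lD; case: Delta cP computable_slice => [//|D'] _ cslice.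
rewrite /newton_sample; set w := sample_weight _ _ _ _ _.
have -> : k%:R%:MP + \sum_(i < r.+1) w i *: slice P a l i =
    gate_op false (k%:R%:MP :: [seq w i *: slice P a l i | i <- enum 'I_r.+1]).
  by rewrite /gate_op big_cons big_map big_enum.
apply: computable_gate_op => //; rewrite -cat1s; apply: computable_cat.
  exact/computable_leaf/leafC.
rewrite -[X in (X * _)%N]size_enum_ord; apply: computable_map => i _.
apply: (@computableZ _ _ _ _ _ [:: _]); apply: computableW (cslice l i) => //.
by rewrite leq_mul2l; apply/orP; right.
Qed.

Definition root_circuit_size : nat := (1 + N * D * D * (N + 2 + sample_size))%N.

Lemma computable_simple_root j : [pchar F] =i pred0 -> (0 < r)%N ->
  (msize P <= r.+1)%N -> (msize f <= d.+1)%N ->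
  (muni P)^`(j).[f] = 0 -> ((muni P)^`(j.+1).[f]).@[a] != 0 ->
  computable false (Delta + 3) root_circuit_size [:: f].
Proof.
move=> char0 r_gt0 P_size f_size Q_root dQ_neq0; rewrite addn3.
rewrite [X in [:: X]](root_formula char0 r_gt0 P_size f_size Q_root dQ_neq0).
pose T : finType := ('I_N * 'I_D * 'I_D)%type.
pose sample (u : T) := newton_sample r P f a j u.1.2 u.2.
pose power (u : T) := root_weight F u *: sample u ^+ u.1.1.+1.
have -> : (f.@[a])%:MP + \sum_(u : T) power u =
    gate_op false ((f.@[a])%:MP :: [seq power u | u <- enum T]).
  by rewrite /gate_op big_cons big_map big_enum.
have cardT : size (enum T) = (N * D * D)%N.
  by rewrite -cardE !card_prod !card_ord.
have cpowers : computable true Delta.+2 (N * D * D * (N.+1 + sample_size))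
    [seq power u | u <- enum T].
  rewrite -cardT; apply: computable_map => u _.
  have -> : power u =
      gate_op true ((root_weight F u)%:MP :: nseq u.1.1.+1 (sample u)).
    by rewrite /gate_op big_cons mul_mpolyC big_nseq -Monoid.iteropE.
  have csample := computable_sample j u.1.2 (ltn_ord u.2).
  apply: computableW (computable_gate _ _ csample) => //.
    by rewrite leq_add2r /= size_nseq ltnS ltn_ord.
  apply/allP => p; rewrite inE => /predU1P[->|/nseqP[-> _]].
    exact/operand_leaf/leafC.
  exact/operand_mem/mem_head.
apply: computableW (computable_gate _ _ cpowers) => //.
  by rewrite /= size_map cardT /root_circuit_size; nia.
apply/allP => p; rewrite inE => /predU1P[->|]; first exact/operand_leaf/leafC.
exact: operand_mem.
Qed.

Lemma root_circuit_size_leq : (0 < s)%N -> (0 < r)%N -> (0 < d)%N ->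
  (root_circuit_size <= (12 ^ 3).+1 * (s * r ^ 4 * d ^ 4))%N.
Proof.
move=> s0 r0 d0; have D_le : (D <= 4 * (r * d))%N by nia.
have count_le : (N * D * D <= 3 * d * (4 * (r * d)) * (4 * (r * d)))%N.
  by rewrite !leq_mul //; lia.
have gate_le : (N + 2 + sample_size <= 36 * (s * (r * (r * d))))%N.
  have d_le : (d <= s * (r * (r * d)))%N.
    by rewrite !mulnA leq_pmull // !muln_gt0 s0 r0.
  have : (r.+1 * (3 * (s * D.+1)) <= 2 * r * (3 * (s * (5 * (r * d)))))%N.
    by rewrite !leq_mul //; nia.
  by rewrite /sample_size; nia.
have srd0 : (0 < s * r ^ 4 * d ^ 4)%N by rewrite !muln_gt0 ?expn_gt0 s0 r0 d0.
rewrite /root_circuit_size [leqRHS]mulSn leq_add //.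
by apply: leq_trans (leq_mul count_le gate_le) _; apply: eq_leq; ring.
Qed.

End RootCircuit.

Lemma computable_root (F : fieldType) n r s Delta d
    (P : {mpoly F[n.+1]}) (f : {mpoly F[n]}) :
  [pchar F] =i pred0 -> P != 0 -> (msize P <= r.+1)%N ->
  computable false Delta s [:: P] -> (msize f <= d.+1)%N -> (muni P).[f] = 0 ->
  computable false (Delta + 3) (root_circuit_size r s d) [:: f].
Proof.
move=> char0 P_neq0 P_size cP f_size P_root.
have r_gt0 : (0 < r)%N := leq_trans (muni_root_msize P_neq0 P_root) P_size.
have mpoly_char0 : [pchar {mpoly F[n]}] =i pred0.
  by move=> p; rewrite (fmorph_pchar (@mpolyC n F)).
have muniP_neq0 : muni P != 0 by rewrite muni_eq0.
have [j [Q_root dQ_neq0]] := derivn_simple_root mpoly_char0 muniP_neq0 P_root.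
have [a dQa_neq0] := mpoly_nonroot char0 dQ_neq0.
exact: (computable_simple_root cP char0 r_gt0 P_size f_size Q_root dQa_neq0).
Qed.

(* For [d = 0] the size is bounded as for [d = 1], since [0 ^ 0 = 1]. *)
Lemma root_circuit_size_maxn1 n r s d : (0 < s)%N -> (0 < r)%N -> (0 < n)%N ->
  (root_circuit_size r s (maxn d 1) <=
   (12 ^ 3).+1 * (s * r * n) ^ 10 * d ^ (4 * (0 < d)))%N.
Proof.
move=> s_gt0 r_gt0 n_gt0; have d_gt0 : (0 < maxn d 1)%N by rewrite leq_max orbT.
apply: leq_trans (root_circuit_size_leq s_gt0 r_gt0 d_gt0) _.
have -> : (maxn d 1 ^ 4 = d ^ (4 * (0 < d)))%N by case: d {d_gt0}.
rewrite mulnA leq_mul // leq_mul //.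
have srn_gt0 : (0 < s * r * n)%N by rewrite !muln_gt0 s_gt0 r_gt0.
apply: leq_trans (leq_pexp2l srn_gt0 (isT : 4 <= 10)%N).
rewrite !expnMn -[leqLHS]muln1 leq_mul ?expn_gt0 ?n_gt0 // leq_mul //.
by rewrite -[leqLHS]expn1 leq_pexp2l.
Qed.

Theorem theorem2p4 :
  exists (C : nat) (e : nat -> nat), bigO_sqrt e /\
  forall (F : fieldType) (n r s Delta d : nat)
         (P : {mpoly F[n.+1]}) (f : {mpoly F[n]}),
    [pchar F] =i pred0 ->
    (0 < n)%N ->
    P != 0 ->
    (msize P <= r.+1)%N ->
    (exists c : circuit F n.+1,
       [/\ computes c P, csize c = s & depth_at_most c Delta]) ->
    (msize f <= d.+1)%N ->
    P \mPo [tuple of rcons [tuple 'X_i | i < n] f] = 0 ->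
    exists c : circuit F n,
      [/\ computes c f,
          depth_at_most c (Delta + 3) &
          (csize c <= C * (s * r * n) ^ 10 * d ^ e d)%N].
Proof.
exists (12 ^ 3).+1, (fun d => 4 * (0 < d))%N; split.
  by exists 4 => d; rewrite expnMn leq_mul2l; case: d.
move=> F n r s Delta d P f char0 n_gt0 P_neq0 P_size [c [cP cs cD]] f_size.
rewrite comp_mpoly_rcons => P_root.
have s_gt0 : (0 < s)%N by rewrite -cs csize_gt0.
have r_gt0 : (0 < r)%N := leq_trans (muni_root_msize P_neq0 P_root) P_size.
have f_size_maxn : (msize f <= (maxn d 1).+1)%N.
  by rewrite (leq_trans f_size) // ltnS leq_maxl.
have /computable_circuit[c' [c'f c'D c'S]] := computable_root
  char0 P_neq0 P_size (circuit_computable cP cD) f_size_maxn P_root.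
exists c'; split=> //; apply: leq_trans c'S _; rewrite cs.
exact: root_circuit_size_maxn1.
Qed.
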